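(* Let $\mathbb{F}$ be a field of characteristic zero, let $W(2)$ be the conservative algebra over $\mathbb{F}$ of all multiplications on a $2$-dimensional vector space, let $W_2\subseteq W(2)$ be the subalgebra of all commutative multiplications, and let $S_2\subseteq W_2$ be the subalgebra of all commutative multiplications with zero multiplication trace. Then, for each algebra $\mathcal{A}\in\{S_2,W_2,W(2)\}$, every local automorphism $\nabla:\mathcal{A}\to\mathcal{A}$ is an automorphism of $\mathcal{A}$.
   Context: Let $V_2$ be a $2$-dimensional vector space over $\mathbb{F}$ with a basis $v_1,v_2$. The algebra $W(2)$ is the $8$-dimensional vector space of all multiplications on $V_2$, i.e. all bilinear maps $V_2\times V_2\to V_2$, with the (nonassociative) product $$(A\cdot B)(x,y)=A(v_1,B(x,y))-B(A(v_1,x),y)-B(x,A(v_1,y)),\qquad x,y\in V_2,\ A,B\in W(2).$$ For $i,j,k\in\{1,2\}$ let $\alpha^k_{ij}\in W(2)$ be given by $\alpha^k_{ij}(v_t,v_l)=\delta_{it}\delta_{jl}v_k$. The subalgebra $W_2\subseteq W(2)$ is the $6$-dimensional subspace of all commutative (symmetric) multiplications. The subalgebra $S_2\subseteq W_2$ is the $4$-dimensional subspace of commutative multiplications with zero multiplication trace (every left multiplication operator has trace zero); it has basis $$e_1=\alpha^1_{11}-\alpha^2_{12}-\alpha^2_{21},\quad e_2=\alpha^2_{11},\quad e_3=\alpha^2_{22}-\alpha^1_{12}-\alpha^1_{21},\quad e_4=\alpha^1_{22}.$$ For a (not necessarily associative) $\mathbb{F}$-algebra $\mathcal{A}$: a bijective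 linear map $\phi:\mathcal{A}\to\mathcal{A}$ is an automorphism if $\phi(xy)=\phi(x)\phi(y)$ for all $x,y\in\mathcal{A}$. A linear map $\nabla:\mathcal{A}\to\mathcal{A}$ is a local automorphism if for every $x\in\mathcal{A}$ there exists an automorphism $\phi_x:\mathcal{A}\to\mathcal{A}$ (depending on $x$) such that $\nabla(x)=\phi_x(x)$. *)

(* Defs.v *)
From HB Require Import structures.
From mathcomp Require Import all_boot all_order all_algebra.

Set Implicit Arguments.
Unset Strict Implicit.
Unset Printing Implicit Defensive.

Import GRing.Theory.
Local Open Scope ring_scope.

Section Automorphisms.
Variables (F : fieldType) (A : lmodType F) (mul : A -> A -> A).

Definition is_automorphism (phi : A -> A) : Prop :=
  [/\ linear phi, bijective phi & {morph phi : x y / mul x y}].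

Definition is_local_automorphism (nabla : A -> A) : Prop :=
  linear nabla /\
  forall x, exists phi : A -> A, is_automorphism phi /\ nabla x = phi x.

End Automorphisms.

(* The product induced on a subspace U; since vsproj projects onto U, this is *)
(* the restriction of mul only when U is a subalgebra, see submulE.           *)
Definition submul (F : fieldType) (A : vectType F) (mul : A -> A -> A)
    (U : {vspace A}) (x y : subvs_of U) : subvs_of U :=
  vsproj U (mul (vsval x) (vsval y)).

Lemma submulE (F : fieldType) (A : vectType F) (mul : A -> A -> A)
    (U : {vspace A}) :
  (forall x y, x \in U -> y \in U -> mul x y \in U) ->
  forall x y : subvs_of U, vsval (submul mul x y) = mul (vsval x) (vsval y).
Proof. by move=> clU x y; rewrite vsprojK // clU ?subvsP. Qed.

Section Trace.
Variables (F : fieldType) (V : vectType F).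

Definition lftrace (f : 'End(V)) : F :=
  \tr (passmx.mxof (vbasis {:V}) (vbasis {:V}) f).

Lemma lftrace_coord n (e : n.-tuple V) (f : 'End(V)) :
  basis_of {:V} e -> lftrace f = \sum_i coord e i (f e`_i).
Proof.
move=> be; have en : n = \dim {:V} by rewrite (size_basis be).
subst n; have bb := vbasisP {:V}.
transitivity (\tr (passmx.mxof e e f)).
  rewrite /lftrace -{1}(comp_lfun1l f) (passmx.mxof_comp _ _ be).
  by rewrite mxtrace_mulC -(passmx.mxof_comp _ _ bb) comp_lfun1r.
apply: eq_bigr => i _; rewrite !mxE /=; congr (coord e i (f _)).
exact: passmx.vecof_delta.
Qed.

Lemma lftrace_is_linear : linear (lftrace : 'End(V) -> F^o).
Proof. by move=> a f g; rewrite /lftrace passmx.mxof_linear mxtraceD mxtraceZ. Qed.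
HB.instance Definition _ :=
  GRing.isLinear.Build F 'End(V) F^o _ lftrace lftrace_is_linear.

Lemma lftraceB (f g : 'End(V)) : lftrace (f - g) = lftrace f - lftrace g.
Proof. exact: (linearB (lftrace : {linear 'End(V) -> F^o})). Qed.

Lemma lftrace_comp (f g : 'End(V)) : lftrace (f \o g)%VF = lftrace (g \o f)%VF.
Proof.
have bb := vbasisP {:V}.
by rewrite /lftrace !(passmx.mxof_comp _ _ bb) mxtrace_mulC.
Qed.

End Trace.

(* Bilinear maps V x V -> V, in curried form. *)
Notation mults V := 'Hom(V, 'Hom(V, V)).

Section Multiplications.
Variables (F : fieldType) (V : vectType F).
Implicit Types (A B : mults V) (x y : V).

Lemma multsP A B : (forall x y, A x y = B x y) -> A = B.
Proof. by move=> eAB; apply/lfunP => x; apply/lfunP => y. Qed.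

(* For dim V = 2, (mults V, mulW v1) is the algebra W(2). *)
Definition mulW (v1 : V) (A B : mults V) : mults V :=
  linfun (fun x : V => linfun (fun y : V =>
    A v1 (B x y) - B (A v1 x) y - B x (A v1 y)) : 'Hom(V, V)).

Lemma bilin_linfunE (f : V -> V -> V) :
  (forall x, linear (f x)) -> (forall y, linear (f^~ y)) ->
  forall x y,
  (linfun (fun x : V => linfun (f x) : 'Hom(V, V)) : mults V) x y = f x y.
Proof.
move=> lr ll x y.
have inE u z : (linfun (f u) : 'Hom(V, V)) z = f u z.
  pose L := GRing.isLinear.Build F V V _ (f u) (lr u).
  pose g : {linear V -> V} := HB.pack (f u) L.
  by rewrite -[f u]/(g : V -> V) lfunE.
have lout : linear (fun x : V => linfun (f x) : 'Hom(V, V)).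
  by move=> a u w; apply/lfunP => z; rewrite !lfun_simp !inE; apply: ll.
pose L := GRing.isLinear.Build F V 'Hom(V, V) _ _ lout.
pose g : {linear V -> 'Hom(V, V)} := HB.pack (fun x : V => linfun (f x)) L.
by rewrite -[fun x => _]/(g : V -> 'Hom(V, V)) lfunE /= inE.
Qed.

Lemma mulWE v1 A B x y :
  mulW v1 A B x y = A v1 (B x y) - B (A v1 x) y - B x (A v1 y).
Proof.
have lin3 (a : F) (p p' q q' r r' : V) :
    (a *: p + p') + (a *: q + q') + (a *: r + r')
      = a *: (p + q + r) + (p' + q' + r').
  by rewrite !scalerDr (addrACA (a *: p)) [LHS]addrACA.
rewrite /mulW (bilin_linfunE (f := fun x y => _)) // => z a u w.
  by rewrite !linearP /= lin3.
by rewrite !linearP /= !lfun_simp !linearP /= lin3.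
Qed.

Definition flipW (A : mults V) : mults V :=
  linfun (fun x : V => linfun (fun y : V => A y x) : 'Hom(V, V)).

Lemma flipWE A x y : flipW A x y = A y x.
Proof.
by rewrite /flipW (bilin_linfunE (f := fun x y => A y x)) // => z a u w; rewrite linearP ?lfun_simp.
Qed.

Lemma flipW_is_linear : linear flipW.
Proof. by move=> a A B; apply: multsP => x y; rewrite !(lfun_simp, flipWE). Qed.
HB.instance Definition _ :=
  GRing.isLinear.Build F (mults V) (mults V) _ flipW flipW_is_linear.

(* For dim V = 2 this is W_2. *)
Definition commW : {vspace mults V} := fixedSpace (linfun flipW).

Lemma memcommW A : reflect (forall x y, A x y = A y x) (A \in commW).
Proof.
apply: (iffP fixedSpaceP); rewrite lfunE /= => cA.
  by move=> x y; rewrite -{1}cA flipWE.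
by apply: multsP => x y; rewrite flipWE.
Qed.

(* The linear form sending x to the trace of left multiplication by x. *)
Definition multtrace (A : mults V) : 'Hom(V, F^o) :=
  linfun (fun x : V => lftrace (A x) : F^o).

Lemma multtraceE A x : multtrace A x = lftrace (A x).
Proof.
have lA : linear (fun x : V => lftrace (A x) : F^o).
  by move=> a u w; rewrite linearP; apply: lftrace_is_linear.
pose L := GRing.isLinear.Build F V F^o _ _ lA.
pose g : {linear V -> F^o} := HB.pack (fun x : V => lftrace (A x) : F^o) L.
by rewrite /multtrace -[fun x => _]/(g : V -> F^o) lfunE.
Qed.

Lemma multtrace_is_linear : linear multtrace.
Proof.
move=> a A B; apply/lfunP => x; rewrite !(lfun_simp, multtraceE).
by exact: lftrace_is_linear.
Qed.
HB.instance Definition _ :=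
  GRing.isLinear.Build F (mults V) 'Hom(V, F^o) _ multtrace multtrace_is_linear.

(* For dim V = 2 this is S_2. *)
Definition tracelessW : {vspace mults V} :=
  (commW :&: lker (linfun multtrace))%VS.

Lemma memtracelessW A :
  reflect ((forall x y, A x y = A y x) /\ (forall x, lftrace (A x) = 0))
          (A \in tracelessW).
Proof.
rewrite memv_cap memv_ker lfunE /=.
apply: (iffP andP) => -[/memcommW cA tA]; split=> //.
  by move=> x; rewrite -multtraceE (eqP tA) lfunE.
by apply/eqP/lfunP => x; rewrite multtraceE tA lfunE.
Qed.

Lemma commW_closed v1 A B :
  A \in commW -> B \in commW -> mulW v1 A B \in commW.
Proof.
move=> _ /memcommW cB; apply/memcommW => x y; rewrite !mulWE.
by rewrite (cB x y) (cB (A v1 x)) (cB x) addrAC.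
Qed.

Lemma tracelessW_closed v1 A B :
  A \in tracelessW -> B \in tracelessW -> mulW v1 A B \in tracelessW.
Proof.
move=> /memtracelessW[cA tA] /memtracelessW[cB tB]; apply/memtracelessW; split.
  by apply/memcommW/commW_closed; apply/memcommW.
move=> x; have -> : mulW v1 A B x =
    (A v1 \o B x)%VF - B (A v1 x) - (B x \o A v1)%VF.
  by apply/lfunP => y; rewrite mulWE !lfun_simp.
by rewrite !lftraceB tB subr0 lftrace_comp subrr.
Qed.

End Multiplications.

(* Main.v *)
Require Import Defs.
From HB Require Import structures.
From mathcomp Require Import all_boot all_order all_algebra.
From mathcomp Require Import ring.
Import GRing.Theory.
Local Open Scope ring_scope.

(* Write L A = A(v1, .) in gl(V).  Then A . B is the natural action of L A on *)
(* the tensor B, and this action is faithful, even on S_2.  An automorphism   *)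
(* phi therefore transports every Lie relation between the L A to the         *)
(* L (phi A), and it preserves the left annihilator {A | L A = 0}, which      *)
(* forces L (phi e1) and L (phi e3) to stabilise the line of v1.  Solving for *)
(* the resulting sl2-triple gives L (phi A) = g (L A) g^-1 for some g fixing  *)
(* v1, so that phi(A)(v1, v1) = g (A(v1, v1)), and g = 1 forces phi = 1.      *)
(* Given a local automorphism nabla, compose it with an automorphism so that  *)
(* it fixes e2, where e2(v1, v1) = v2.  If A(v1, v1) = a v1, then evaluating  *)
(* e2 + nabla A = phi (e2 + A) at (v1, v1) yields v2 + a v1 = g v2 + a v1:    *)
(* hence phi = 1 and nabla A = A.  Such A and e2 span the algebra.            *)

(** One argument serves all three algebras, since it only uses that the algebra embeds by [iota]
    into W(2) and that the image contains the four tensors [basisS]. [mulW_commutator] and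
    [action_faithful] yield the transport of relations in [aut_relation]; [aut_borel] and
    [sl2_triple_borel] turn it into [aut_structure]. An automorphism is thus as rigid as a linear
    map fixing v1: it preserves the value at (v1, v1) when this lies on the line of v1, and it is
    the identity once it also preserves a value off that line, normalised to second coordinate 1.
    [local_automorphism_fix_e2] exploits this by testing a local automorphism at sums e2 + w. *)

Lemma homE (F : fieldType) (V W : vectType F) (f : 'Hom(V, W)) :
  (forall x y, f (x + y) = f x + f y) * (forall x, f (- x) = - f x) *
  (forall a x, f (a *: x) = a *: f x) * (f 0 = 0).
Proof.
split; last exact: linear0.
split; last by move=> a x; rewrite linearZ.
by split; [exact: linearD | exact: linearN].
Qed.

(** Linear-combination certificates: the coefficients are supplied by hand and [ring] or [field]
    checks the remaining identity. *)
Lemma lincomb1 (R : comNzRingType) (k l r x y : R) :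
  l = r -> x - y = k * (l - r) -> x = y.
Proof. by move=> ->; rewrite subrr mulr0 => /subr0_eq. Qed.

Lemma lincomb2 (R : comNzRingType) (k k' l r l' r' x y : R) :
  l = r -> l' = r' -> x - y = k * (l - r) + k' * (l' - r') -> x = y.
Proof. by move=> -> ->; rewrite !subrr !mulr0 addr0 => /subr0_eq. Qed.
Arguments lincomb1 {R} k {l r x y}.
Arguments lincomb2 {R} k k' {l r l' r' x y}.

(** * Coordinates on V and the basis of S_2 *)

Section TwoDimensional.
Variables (F : fieldType) (V : vectType F) (v1 v2 : V).
Hypothesis basis_v : basis_of fullv [:: v1; v2].

Let e : 2.-tuple V := [tuple of [:: v1; v2]].
Let c1 (x : V) : F := coord e 0 x.
Let c2 (x : V) : F := coord e 1 x.

Lemma free_v : free e. Proof. exact: basis_free basis_v. Qed.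

Lemma decomp x : x = c1 x *: v1 + c2 x *: v2.
Proof.
rewrite {1}(coord_basis (X := e) basis_v (memvf x)) big_ord_recl big_ord1.
by have -> : lift ord0 ord0 = 1 :> 'I_2 by exact: val_inj.
Qed.

Lemma coordE :
  (forall x y, c1 (x + y) = c1 x + c1 y) *
  (forall x y, c2 (x + y) = c2 x + c2 y) *
  (forall x, c1 (- x) = - c1 x) * (forall x, c2 (- x) = - c2 x) *
  (forall (a : F) x, c1 (a *: x) = a * c1 x) *
  (forall (a : F) x, c2 (a *: x) = a * c2 x) *
  (c1 0 = 0) * (c2 0 = 0) *
  (c1 v1 = 1) * (c1 v2 = 0) * (c2 v1 = 0) * (c2 v2 = 1).
Proof.
split; last exact: (coord_free 1 1 free_v).
split; last exact: (coord_free 0 1 free_v).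
split; last exact: (coord_free 1 0 free_v).
split; last exact: (coord_free 0 0 free_v).
split; last exact: linear0.
split; last exact: linear0.
split; last by move=> a x; rewrite /c2 linearZ.
split; last by move=> a x; rewrite /c1 linearZ.
split; last exact: linearN.
split; last exact: linearN.
by split; exact: linearD.
Qed.

Lemma vec_eq x y : c1 x = c1 y -> c2 x = c2 y -> x = y.
Proof. by move=> e1 e2; rewrite (decomp x) (decomp y) e1 e2. Qed.

Lemma end_eq (W : vectType F) (f g : 'Hom(V, W)) :
  f v1 = g v1 -> f v2 = g v2 -> f = g.
Proof.
by move=> e1 e2; apply/lfunP=> x; rewrite (decomp x) !homE e1 e2.
Qed.

(** The rank-one tensor f ⊗ g ⊗ z; for coordinate forms and a basis vector it is an α^k_ij. *)
Definition elemW (f g : V -> F) (z : V) : mults V :=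
  linfun (fun x : V => linfun (fun y : V => (f x * g y) *: z) : 'Hom(V, V)).

Lemma elemWE f g z x y :
    (forall a u w, f (a *: u + w) = a * f u + f w) ->
    (forall a u w, g (a *: u + w) = a * g u + g w) ->
  elemW f g z x y = (f x * g y) *: z.
Proof.
move=> lf lg.
rewrite /elemW (bilin_linfunE (f := fun x y => (f x * g y) *: z)) //.
  by move=> a u b w; rewrite lg scalerA -scalerDl; congr (_ *: _); ring.
by move=> u a b w; rewrite lf scalerA -scalerDl; congr (_ *: _); ring.
Qed.

Lemma coord_elemWE z x y : (elemW c1 c1 z x y = (c1 x * c1 y) *: z) *
  (elemW c1 c2 z x y = (c1 x * c2 y) *: z) *
  (elemW c2 c1 z x y = (c2 x * c1 y) *: z) *
  (elemW c2 c2 z x y = (c2 x * c2 y) *: z).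
Proof. by do !split; apply: elemWE => a u w; rewrite !coordE. Qed.

Definition basisS1 := elemW c1 c1 v1 - elemW c1 c2 v2 - elemW c2 c1 v2.
Definition basisS2 := elemW c1 c1 v2.
Definition basisS3 := elemW c2 c2 v2 - elemW c1 c2 v1 - elemW c2 c1 v1.
Definition basisS4 := elemW c2 c2 v1.
Definition basisS := [:: basisS1; basisS2; basisS3; basisS4].

Lemma mem_basisS D : (D \in basisS) =
  [|| D == basisS1, D == basisS2, D == basisS3 | D == basisS4].
Proof. by rewrite !inE. Qed.

Lemma basisS1E x y :
  basisS1 x y = (c1 x * c1 y) *: v1 - (c1 x * c2 y + c2 x * c1 y) *: v2.
Proof. by rewrite !lfun_simp !coord_elemWE scalerDl opprD addrA. Qed.

Lemma basisS2E x y : basisS2 x y = (c1 x * c1 y) *: v2.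
Proof. by rewrite !coord_elemWE. Qed.

Lemma basisS3E x y :
  basisS3 x y = (c2 x * c2 y) *: v2 - (c1 x * c2 y + c2 x * c1 y) *: v1.
Proof. by rewrite !lfun_simp !coord_elemWE scalerDl opprD addrA. Qed.

Lemma basisS4E x y : basisS4 x y = (c2 x * c2 y) *: v1.
Proof. by rewrite !coord_elemWE. Qed.

Lemma lftraceE f : lftrace f = c1 (f v1) + c2 (f v2).
Proof.
rewrite (lftrace_coord (e := e) _ basis_v) big_ord_recl big_ord1.
by have -> : lift ord0 ord0 = 1 :> 'I_2 by exact: val_inj.
Qed.

Let SE := (basisS1E, basisS2E, basisS3E, basisS4E).

Lemma basisS_traceless A : A \in basisS -> A \in tracelessW V.
Proof.
rewrite mem_basisS => inA; apply/memtracelessW; split=> [x y|x].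
  by case/or4P: inA => /eqP ->; rewrite !SE; apply: vec_eq; rewrite !coordE;
    ring.
by case/or4P: inA => /eqP ->; rewrite lftraceE !SE !coordE; ring.
Qed.


(** * The action of gl(V) on multiplications, and sl2-triples *)

(** The action is a Lie algebra representation: the mixed terms of the two double products cancel,
    leaving the action of [L A, L B] + L C. *)
Lemma mulW_commutator (A B C D : mults V) x y :
  let T u := A v1 (B v1 u) - B v1 (A v1 u) + C v1 u in
  mulW v1 A (mulW v1 B D) x y - mulW v1 B (mulW v1 A D) x y + mulW v1 C D x y
  = T (D x y) - D (T x) y - D x (T y).
Proof.
move=> T; rewrite !mulWE /T !homE !(add_lfunE, opp_lfunE).
by apply: vec_eq; rewrite !coordE; ring.
Qed.

Hypothesis charF0 : [pchar F] =i pred0.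

Lemma nat_neq0 n : n.+1%:R != 0 :> F.
Proof. by have /pcharf0P -> := charF0. Qed.

(** A scalar l acts by l - 2l = -l, which explains the sign; the content is faithfulness on S_2. The
    tensors α^2_11 and α^1_22 suffice: they kill the off-diagonal entries of a and give a linear
    system of determinant -3 for the diagonal ones. *)
Lemma action_faithful (a : 'End(V)) (l : F) :
    (forall D, D \in basisS ->
       forall x y, a (D x y) - D (a x) y - D x (a y) = - l *: D x y) ->
  forall x, a x = l *: x.
Proof.
move=> aS x.
have in2 : basisS2 \in basisS by rewrite mem_basisS eqxx !orbT.
have in4 : basisS4 \in basisS by rewrite mem_basisS eqxx !orbT.
have E42 := congr1 c1 (aS _ in4 v1 v2); have E44 := congr1 c1 (aS _ in4 v2 v2).
have E21 := congr1 c1 (aS _ in2 v1 v1); have E22 := congr1 c2 (aS _ in2 v1 v1).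
move: E42 E44 E21 E22; rewrite !SE !(homE, coordE) => E42 E44 E21 E22.
have a21 : c2 (a v1) = 0 by apply: (lincomb1 (-1) E42); ring.
have a12 : c1 (a v2) = 0 by apply: (lincomb1 1 E21); ring.
have a11 : c1 (a v1) = l.
  by apply: (mulfI (nat_neq0 2)); apply: (lincomb2 (-1) (- 2%:R) E44 E22); ring.
have a22 : c2 (a v2) = l by apply: (lincomb2 1 2%:R E22 a11); ring.
suff -> : a = l *: \1%VF by rewrite !lfun_simp.
by apply: end_eq; apply: vec_eq;
  rewrite !lfun_simp !coordE ?a11 ?a12 ?a21 ?a22; ring.
Qed.


(** Here (X1, -X3, X2) satisfies the relations of a standard triple (h, e, f), with h and e upper
    triangular. So e is nilpotent and v1 is its highest weight vector, of weight 1; prescribing f v1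
    removes the remaining freedom. *)
Lemma sl2_triple_borel (X1 X2 X3 : 'End(V)) :
    c2 (X1 v1) = 0 -> c2 (X3 v1) = 0 -> X3 != 0 ->
    (forall u, X1 (X3 u) - X3 (X1 u) = 2%:R *: X3 u) ->
    (forall u, X1 (X2 u) - X2 (X1 u) = - 2%:R *: X2 u) ->
    (forall u, X2 (X3 u) - X3 (X2 u) = X1 u) ->
  [/\ X1 v1 = v1, X3 v1 = 0 &
      X2 v1 = v2 -> [/\ X1 v2 = - v2, X2 v2 = 0 & X3 v2 = - v1]].
Proof.
move=> X1_21 X3_21 X3_neq0 X13 X12 X23.
have decomp1 : X1 v1 = c1 (X1 v1) *: v1.
  by rewrite [LHS]decomp X1_21 scale0r addr0.
have decomp3 : X3 v1 = c1 (X3 v1) *: v1.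
  by rewrite [LHS]decomp X3_21 scale0r addr0.
move: (decomp (X1 v2)) (decomp (X2 v1)) (decomp (X2 v2)) (decomp (X3 v2)).
move: decomp1 decomp3.
(* The images of v1 and v2 have coordinates (h, 0), (b, k) for X1, (p, r), (q, l) for X2 and (t, 0),
   (s, m) for X3. *)
move: (c1 (X1 v1)) (c1 (X1 v2)) (c2 (X1 v2)) => h b k.
move: (c1 (X2 v1)) (c2 (X2 v1)) (c1 (X2 v2)) (c2 (X2 v2)) => p r q l.
move: (c1 (X3 v1)) (c1 (X3 v2)) (c2 (X3 v2)) => t s m.
move=> X11 X31 X12' X21 X22 X32.
have XE := (X11, X31, X12', X21, X22, X32).
have two_neq0 := nat_neq0 1.
have := congr1 c1 (X13 v1); rewrite !(XE, homE, coordE) => E1.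
have t0 : t = 0.
  by apply: (mulfI two_neq0); apply: (lincomb1 (-1) E1); ring.
have := congr1 c2 (X13 v2); rewrite !(XE, homE, coordE) => E2.
have m0 : m = 0.
  by apply: (mulfI two_neq0); apply: (lincomb1 (-1) E2); ring.
have s_neq0 : s != 0.
  apply: contraNneq X3_neq0 => s0; apply/eqP/end_eq; rewrite XE.
    by rewrite t0 scale0r lfunE.
  by rewrite s0 m0 !scale0r addr0 lfunE.
subst t m.
have := congr1 c1 (X13 v2); rewrite !(XE, homE, coordE) => E3.
have hk : h - k = 2%:R.
  by apply: (mulfI s_neq0); apply: (lincomb1 1 E3); ring.
(* X1 is a commutator, hence has trace zero. *)
have := congr1 c1 (X23 v1); rewrite !(XE, homE, coordE) => E4.
have := congr1 c2 (X23 v2); rewrite !(XE, homE, coordE) => E5.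
have kh : k = - h by apply: (lincomb2 (-1) (-1) E4 E5); ring.
have h1 : h = 1.
  by apply: (mulfI two_neq0); apply: (lincomb2 1 1 hk kh); ring.
subst k h.
have := congr1 c1 (X12 v1); rewrite !(XE, homE, coordE) => E7.
have := congr1 c2 (X12 v2); rewrite !(XE, homE, coordE) => E8.
have := congr1 c1 (X12 v2); rewrite !(XE, homE, coordE) => E9.
split; rewrite ?XE ?scale1r ?scale0r // => wE.
have := congr1 c1 wE; rewrite !coordE => E10.
have p0 : p = 0 by apply: (lincomb1 1 E10); ring.
have := congr1 c2 wE; rewrite !coordE => E11.
have r1 : r = 1 by apply: (lincomb1 1 E11); ring.
subst p r.
have b0 : b = 0 by apply: (lincomb1 1 E7); ring.
subst b.
have l0 : l = 0.
  by apply: (mulfI two_neq0); apply: (lincomb1 1 E8); ring.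
have s1 : s = -1 by apply: (lincomb1 1 E5); ring.
(* The entry q has weight 2 under X1 while X2 has weight -2, so 4q = 0. *)
have q0 : q = 0.
  by apply: (mulfI (nat_neq0 3)); apply: (lincomb2 1 0 E9 l0); ring.
by rewrite s1 q0 l0 !scale0r !add0r !addr0 !scaleN1r.
Qed.

(** * Automorphisms of an algebra between S_2 and W(2) *)

Section Subalgebra.
Variables (A : lmodType F) (mul : A -> A -> A) (iota : {linear A -> mults V}).
Hypothesis iota_inj : injective iota.
Hypothesis iotaM : {morph iota : x y / mul x y >-> mulW v1 x y}.
Hypothesis iota_basisS :
  forall D, D \in basisS -> exists x, iota x = D.

Let L x : 'End(V) := iota x v1.

Section Automorphism.
Variables (phi : {linear A -> A}) (psi : A -> A).
Hypotheses (phiK : cancel phi psi) (psiK : cancel psi phi).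
Hypothesis phiM : {morph phi : x y / mul x y}.

(* Left multiplications determine L by faithfulness, so a relation among the *)
(* L's is an identity between left multiplications, which phi preserves.     *)
Lemma aut_relation x y z (l : F) :
    (forall u, L x (L y u) - L y (L x u) + L z u = l *: u) ->
  forall u, L (phi x) (L (phi y) u) - L (phi y) (L (phi x) u) + L (phi z) u
    = l *: u.
Proof.
have act x' y' z' d u w :
    iota (mul x' (mul y' d) - mul y' (mul x' d) + mul z' d) u w =
    let T t := L x' (L y' t) - L y' (L x' t) + L z' t in
    T (iota d u w) - iota d (T u) w - iota d u (T w).
  by rewrite linearD linearB !iotaM !add_lfunE !opp_lfunE mulW_commutator.
move=> Lxyz u.
(* The relation, as an identity between left multiplications. *)
have mulxyz d : mul x (mul y d) - mul y (mul x d) + mul z d = - l *: d.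
  apply: iota_inj; apply: multsP => t w.
  rewrite act /= !Lxyz [iota (_ *: _)]linearZ /=.
  by apply: vec_eq; rewrite !(lfun_simp, homE, coordE) /=; ring.
pose T : 'End(V) :=
  ((L (phi x) \o L (phi y)) - (L (phi y) \o L (phi x)) + L (phi z))%VF.
have TE v : T v =
    L (phi x) (L (phi y) v) - L (phi y) (L (phi x) v) + L (phi z) v.
  by rewrite /T !lfun_simp.
rewrite -TE; apply: action_faithful => _ /iota_basisS[d <-] t w.
rewrite !TE; have /= <- := act (phi x) (phi y) (phi z) d t w.
rewrite -(psiK d) -!phiM -linearB -linearD.
by rewrite mulxyz !linearZ !lfun_simp.
Qed.

(** Since L e4 = 0, also L (phi e4) = 0. If L (phi x) v1 had a v2-component, applying phi to x e4 =
    k e4 and evaluating at (v1, u) would force [iota (phi e4)] to vanish at v2 as well, so phi e4 =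
    0. *)
Lemma aut_borel x k e4 : iota e4 = basisS4 -> mul x e4 = k *: e4 ->
  c2 (L (phi x) v1) = 0.
Proof.
move=> e4E xe4.
have Le4 u : L (phi e4) u = 0.
  have := @aut_relation 0 0 e4 0 _ u; rewrite !linear0 /L !linear0 !lfun_simp.
  rewrite subr0 add0r scale0r; apply => {}u.
  by rewrite !lfun_simp subr0 add0r scale0r e4E SE !coordE !mul0r scale0r.
have [//|b_neq0] := eqVneq (c2 (L (phi x) v1)) 0.
have Lv2 : iota (phi e4) v2 = 0.
  apply/lfunP => u; have := congr1 (fun B => iota B v1 u) (phiM x e4).
  rewrite xe4 !linearZ iotaM mulWE !lfun_simp.
  rewrite -![iota (phi e4) v1]/(L (phi e4)) !Le4.
  rewrite [iota (phi x) v1 v1]decomp !homE !lfun_simp /= Le4.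
  rewrite !scaler0 subr0 sub0r add0r => /esym/eqP.
  by rewrite oppr_eq0 scaler_eq0 (negPf b_neq0) => /eqP.
have : iota (phi e4) = 0.
  by apply: end_eq; rewrite lfunE //=; apply/lfunP => u; rewrite lfunE Le4.
rewrite -(linear0 iota) => /iota_inj; rewrite -(linear0 phi) => /(can_inj phiK).
move=> e40; have := basisS4E v2 v2; rewrite -e4E e40 linear0.
rewrite !lfunE !coordE => /(congr1 c1); rewrite !coordE => /eqP.
by rewrite eq_sym !mulr1 oner_eq0.
Qed.

Lemma aut_structure :
  [/\ forall x, c2 (L x v1) = 0 -> L (phi x) v1 = L x v1 &
      (forall x, L x v1 = v2 -> L (phi x) v1 = v2) -> phi =1 id].
Proof.
have [|e1 e1E] := @iota_basisS basisS1; first by rewrite mem_basisS eqxx.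
have [|e2 e2E] := @iota_basisS basisS2; first by rewrite mem_basisS eqxx !orbT.
have [|e3 e3E] := @iota_basisS basisS3; first by rewrite mem_basisS eqxx !orbT.
have [|e4 e4E] := @iota_basisS basisS4; first by rewrite mem_basisS eqxx !orbT.
have LE1 u : L e1 u = c1 u *: v1 - c2 u *: v2.
  by rewrite /L e1E SE; apply: vec_eq; rewrite !coordE; ring.
have LE2 u : L e2 u = c1 u *: v2.
  by rewrite /L e2E SE; apply: vec_eq; rewrite !coordE; ring.
have LE3 u : L e3 u = - c2 u *: v1.
  by rewrite /L e3E SE; apply: vec_eq; rewrite !coordE; ring.
have LZ a x u : L (a *: x) u = a *: L x u by rewrite /L linearZ !lfun_simp.
have LB x y u : L (x - y) u = L x u - L y u by rewrite /L linearB !lfun_simp.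
have eq_rel x y z u w : L x (L y u) - L y (L x u) + L z u = 0 *: w ->
    L x (L y u) - L y (L x u) = - L z u.
  by rewrite scale0r => /eqP; rewrite addr_eq0 => /eqP.
have X13 u : L (phi e1) (L (phi e3) u) - L (phi e3) (L (phi e1) u)
    = 2%:R *: L (phi e3) u.
  rewrite (eq_rel _ _ (phi (- 2%:R *: e3)) _ u); last first.
    apply: aut_relation => {}u; rewrite LZ !LE1 !LE3.
    by apply: vec_eq; rewrite !coordE; ring.
  by rewrite linearZ /= LZ scaleNr opprK.
have X12 u : L (phi e1) (L (phi e2) u) - L (phi e2) (L (phi e1) u)
    = - 2%:R *: L (phi e2) u.
  rewrite (eq_rel _ _ (phi (2%:R *: e2)) _ u); last first.
    apply: aut_relation => {}u; rewrite LZ !LE1 !LE2.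
    by apply: vec_eq; rewrite !coordE; ring.
  by rewrite linearZ /= LZ scaleNr.
have X23 u : L (phi e2) (L (phi e3) u) - L (phi e3) (L (phi e2) u)
    = L (phi e1) u.
  rewrite (eq_rel _ _ (phi (-1 *: e1)) _ u); last first.
    apply: aut_relation => {}u; rewrite LZ !LE1 !LE2 !LE3.
    by apply: vec_eq; rewrite !coordE; ring.
  by rewrite linearZ /= LZ scaleN1r opprK.
(* L e1 has weights 1 and -1 on v1 and v2, so α^1_22 has weight 1 + 2 = 3. *)
have X1_21 : c2 (L (phi e1) v1) = 0.
  apply: (@aut_borel e1 3%:R e4 e4E); apply: iota_inj; apply: multsP => u w.
  rewrite iotaM [iota (_ *: _)]linearZ /= mulWE e1E e4E !scale_lfunE !SE.
  by apply: vec_eq; rewrite !coordE; ring.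
have X3_21 : c2 (L (phi e3) v1) = 0.
  apply: (@aut_borel e3 0 e4 e4E); apply: iota_inj; apply: multsP => u w.
  rewrite iotaM [iota (_ *: _)]linearZ /= mulWE e3E e4E !scale_lfunE !SE.
  by apply: vec_eq; rewrite !coordE; ring.
(* Otherwise phi would kill e3 e2 = -e1. *)
have X3_neq0 : L (phi e3) != 0.
  apply/eqP => X3_0.
  have e3e2 : mul e3 e2 = - e1.
    apply: iota_inj; apply: multsP => u w.
    rewrite iotaM [iota (- _)]linearN /= mulWE e1E e2E e3E !opp_lfunE !SE.
    by apply: vec_eq; rewrite !coordE; ring.
  have : phi (mul e3 e2) = 0.
    apply: iota_inj; rewrite phiM iotaM linear0; apply: multsP => u w.
    by rewrite mulWE -/(L (phi e3)) X3_0 !(homE, lfun_simp) !subr0.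
  rewrite e3e2 linearN => /(canRL opprK); rewrite oppr0 -(linear0 phi).
  move=> /(can_inj phiK) e10; have := LE1 v1; rewrite e10 /L linear0 !lfunE.
  by move=> /(congr1 c1) /eqP;
    rewrite !coordE !mulr0 subr0 mulr1 eq_sym oner_eq0.
have [X1v1 X3v1 rigid] :=
  sl2_triple_borel _ _ _ X1_21 X3_21 X3_neq0 X13 X12 X23.
have two_neq0 := nat_neq0 1.
(* The identity, L e1, L e2 and L e3 span gl(V). Subtracting the traceless part of L x leaves a y
   with L y = l scalar, and [aut_relation] at (0, 0, y) gives L (phi y) = l. *)
have LphiE x u : L (phi x) u =
    ((c1 (L x v1) + c2 (L x v2)) / 2%:R) *: u
    + ((c1 (L x v1) - c2 (L x v2)) / 2%:R) *: L (phi e1) u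
    + c2 (L x v1) *: L (phi e2) u - c1 (L x v2) *: L (phi e3) u.
  set l := _ / _; set a := _ / _.
  pose y := x - a *: e1 - c2 (L x v1) *: e2 - (- c1 (L x v2)) *: e3.
  have Ly w : L y w = l *: w.
    suff -> : L y = l *: \1%VF by rewrite !lfun_simp.
    by apply: end_eq; apply: vec_eq;
      rewrite /y !LB !LZ LE1 LE2 LE3 !lfun_simp !coordE /l /a; field.
  have := @aut_relation 0 0 y l _ u; rewrite !linear0 /L !linear0 !lfun_simp.
  rewrite subr0 add0r -/(L (phi y)) => <-; last first.
    by move=> w; rewrite !lfun_simp subr0 add0r -/(L y) Ly.
  have -> : phi y = phi x - a *: phi e1 - c2 (L x v1) *: phi e2
      - (- c1 (L x v2)) *: phi e3 by rewrite !linearB !linearZ.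
  by rewrite !LB !LZ; apply: vec_eq; rewrite !coordE; ring.
split=> [x x21|fix_v2 x].
  rewrite LphiE X1v1 X3v1 x21 [RHS]decomp x21.
  by apply: vec_eq; rewrite !coordE; field.
have X2v1 : L (phi e2) v1 = v2.
  by apply: fix_v2; rewrite LE2 coordE scale1r.
have [X1v2 X2v2 X3v2] := rigid X2v1.
have Lphi y : L (phi y) = L y.
  apply: end_eq; rewrite LphiE ?X1v1 ?X2v1 ?X3v1 ?X1v2 ?X2v2 ?X3v2.
    by apply: vec_eq; rewrite !coordE; field.
  by apply: vec_eq; rewrite !coordE; field.
apply: iota_inj; apply: end_eq; first exact: Lphi.
(* As L e2 sends v1 to v2, expanding L (e2 x) u recovers the value of x at (v2, u), the other terms
   depending only on L x. *)
apply/lfunP => u; have /lfunP/(_ u) := Lphi (mul e2 x).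
rewrite phiM /L !iotaM !mulWE -!/(L _) !Lphi !LE2 coordE scale1r.
by move=> /addIr /addrI /oppr_inj.
Qed.

End Automorphism.

(** * From automorphisms to local automorphisms *)

Lemma automorphism_fix_borel f x : is_automorphism mul f ->
  c2 (L x v1) = 0 -> L (f x) v1 = L x v1.
Proof.
case=> f_lin [g fK gK] fM.
pose phi : {linear A -> A} := HB.pack f (GRing.isLinear.Build F A A _ f f_lin).
by have [fix_borel _] := @aut_structure phi g fK gK fM; apply: fix_borel.
Qed.

(** One x suffices: if L y v1 = v2, then L (y - x) v1 lies on the line of v1 and is preserved, hence
    so is L y v1. *)
Lemma automorphism_rigid f x : is_automorphism mul f ->
  c2 (L x v1) = 1 -> L (f x) v1 = L x v1 -> f =1 id.
Proof.
move=> f_aut x21 fx; case: (f_aut) => f_lin [g fK gK] fM.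
pose phi : {linear A -> A} := HB.pack f (GRing.isLinear.Build F A A _ f f_lin).
have [_ rigid] := @aut_structure phi g fK gK fM; apply: rigid => y y1.
have LD u w z : L (u + w) z = L u z + L w z by rewrite /L linearD !lfun_simp.
have LB u w z : L (u - w) z = L u z - L w z by rewrite /L linearB !lfun_simp.
have /= := @automorphism_fix_borel f (y - x) f_aut.
rewrite -[f]/(phi : A -> A) linearB !LB /= fx y1 !coordE x21 subrr.
by move=> /(_ erefl) /addIr.
Qed.

Lemma automorphism_comp f g : is_automorphism mul f -> is_automorphism mul g ->
  is_automorphism mul (f \o g).
Proof.
move=> [f_lin f_bij fM] [g_lin g_bij gM]; split.
- by move=> a x y /=; rewrite g_lin f_lin.
- exact: bij_comp.
- by move=> x y /=; rewrite gM fM.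
Qed.

Lemma automorphism_inv f : is_automorphism mul f ->
  exists2 g, is_automorphism mul g & cancel g f.
Proof.
move=> [f_lin [g fK gK] fM]; exists g => //; split; last 1 first.
- by move=> x y; apply: (canLR fK); rewrite fM !gK.
- by move=> a x y; apply: (canLR fK); rewrite f_lin !gK.
- by exists f.
Qed.

Lemma local_automorphism_fix_e2 nabla e2 :
  is_local_automorphism mul nabla -> iota e2 = basisS2 -> nabla e2 = e2 ->
  nabla =1 id.
Proof.
move=> [nabla_lin nabla_loc] e2E nabla_e2.
have Le2 : L e2 v1 = v2 by rewrite /L e2E SE coordE mulr1 scale1r.
pose N : {linear A -> A} :=
  HB.pack nabla (GRing.isLinear.Build F A A _ nabla nabla_lin).
have nablaD x y : nabla (x + y) = nabla x + nabla y by exact: (linearD N).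
have nablaZ a : nabla (a *: e2) = a *: e2.
  by rewrite -[in RHS]nabla_e2; exact: (linearZ_LR N).
have LD u w z : L (u + w) z = L u z + L w z by rewrite /L linearD !lfun_simp.
have LB u w z : L (u - w) z = L u z - L w z by rewrite /L linearB !lfun_simp.
have LZ a u z : L (a *: u) z = a *: L u z by rewrite /L linearZ !lfun_simp.
have nabla_borel w : c2 (L w v1) = 0 -> nabla w = w.
  move=> w21; have [chi [chi_aut chiE]] := nabla_loc w.
  have [theta [theta_aut thetaE]] := nabla_loc (e2 + w).
  have thetaI : theta =1 id.
    apply: (@automorphism_rigid theta (e2 + w)) => //.
      by rewrite LD Le2 !coordE w21 addr0.
    (* [theta] sends e2 + w to e2 + [chi] w, and [chi] preserves the value of w at (v1, v1), so
       [theta] is rigid. *)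
    rewrite -thetaE nablaD nabla_e2 !LD chiE; congr (_ + _).
    exact: automorphism_fix_borel.
  by apply: (addrI e2); rewrite -{1}nabla_e2 -nablaD thetaE thetaI.
move=> x; set b := c2 (L x v1).
have -> : x = (x - b *: e2) + b *: e2 by rewrite subrK.
rewrite nablaD nablaZ nabla_borel //.
by rewrite LB LZ Le2 !coordE mulr1 subrr.
Qed.

Lemma local_automorphism_automorphism nabla :
  is_local_automorphism mul nabla -> is_automorphism mul nabla.
Proof.
move=> [nabla_lin nabla_loc].
have [|e2 e2E] := @iota_basisS basisS2; first by rewrite mem_basisS eqxx !orbT.
have [phi [phi_aut nabla_e2]] := nabla_loc e2.
have [psi psi_aut psiK] := automorphism_inv _ phi_aut.
have [psi_lin psi_bij _] := psi_aut.
have phiK : cancel phi psi by apply/(bij_can_sym psi_bij).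
(* [psi] undoes the automorphism agreeing with [nabla] at e2, so the composite is a local
   automorphism fixing e2. *)
suff fixN : psi \o nabla =1 id.
  have nablaE : nabla =1 phi by move=> x; rewrite -{2}(fixN x) /= psiK.
  have [_ phi_bij phiM] := phi_aut; split=> //.
    by apply: eq_bij phi_bij _ _ => x; rewrite nablaE.
  by move=> x y; rewrite !nablaE.
apply: (@local_automorphism_fix_e2 _ e2) => //;
  last by rewrite /= nabla_e2 phiK.
split=> [a x y | x] /=; first by rewrite nabla_lin psi_lin.
have [chi [chi_aut ->]] := nabla_loc x.
by exists (psi \o chi); split=> //; apply: automorphism_comp.
Qed.

End Subalgebra.
End TwoDimensional.

Theorem theorem6p1 (F : fieldType) (charF0 : [pchar F] =i pred0)
    (V : vectType F) (v1 v2 : V) (basis_v : basis_of fullv [:: v1; v2]) :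
  (forall nabla : subvs_of (tracelessW V) -> subvs_of (tracelessW V),
     is_local_automorphism (submul (mulW v1) (U := tracelessW V)) nabla ->
     is_automorphism (submul (mulW v1) (U := tracelessW V)) nabla) /\
  (forall nabla : subvs_of (commW V) -> subvs_of (commW V),
     is_local_automorphism (submul (mulW v1) (U := commW V)) nabla ->
     is_automorphism (submul (mulW v1) (U := commW V)) nabla) /\
  (forall nabla : mults V -> mults V,
     is_local_automorphism (mulW v1) nabla ->
     is_automorphism (mulW v1) nabla).
Proof.
have traceless := basisS_traceless _ _ _ _ basis_v.
split; [|split] => nabla.
- apply: (@local_automorphism_automorphism _ _ v1 v2 basis_v charF0 _ _ vsval).
  + exact: val_inj.
  + exact/submulE/tracelessW_closed.
  + by move=> D /traceless D_tr; exists (vsproj _ D); exact: vsprojK.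
- apply: (@local_automorphism_automorphism _ _ v1 v2 basis_v charF0 _ _ vsval).
  + exact: val_inj.
  + exact/submulE/commW_closed.
  + move=> D /traceless; rewrite memv_cap => /andP[D_comm _].
    by exists (vsproj _ D); exact: vsprojK.
- apply: (@local_automorphism_automorphism _ _ v1 v2 basis_v charF0 _ _ idfun);
    move=> //.
  by move=> D _; exists D.
Qed.
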